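(* Let $K\in\mathcal{B}(\mathcal{H})$ and let $(\Phi,\Psi)=(\{\Phi_i\}_{i\in I},\{\Psi_i\}_{i\in I})$, with $\Phi_i,\Psi_i\in\mathcal{B}(\mathcal{H},\mathcal{K}_i)$ for all $i\in I$, be a bi-$g$-frame for $\mathcal{H}$ with respect to $\{\mathcal{K}_i\}_{i\in I}$, with bi-$g$-frame operator $S_{\Phi,\Psi}$ whose square root satisfies $\left(S_{\Phi,\Psi}^{1/2}\right)^{*}=S_{\Phi,\Psi}^{1/2}$. Then $(\Phi,\Psi)$ is a $K$-bi-$g$-frame for $\mathcal{H}$ with respect to $\{\mathcal{K}_i\}_{i\in I}$ if and only if $K=S_{\Phi,\Psi}^{1/2}U$ for some $U\in\mathcal{B}(\mathcal{H})$.
   Context: $\mathcal{H}$ is a separable Hilbert space, $I$ is a finite or countable index set, and $\{\mathcal{K}_i\}_{i\in I}$ is a sequence of closed subspaces of $\mathcal{H}$. $\mathcal{B}(\mathcal{H},\mathcal{K})$ is the set of bounded linear operators $\mathcal{H}\to\mathcal{K}$, and $\mathcal{B}(\mathcal{H})=\mathcal{B}(\mathcal{H},\mathcal{H})$. A pair $(\{\Phi_i\}_{i\in I},\{\Psi_i\}_{i\in I})$ with $\Phi_i,\Psi_i\in\mathcal{B}(\mathcal{H},\mathcal{K}_i)$ is a bi-$g$-frame for $\mathcal{H}$ with respect to $\{\mathcal{K}_i\}_{i\in I}$ if there exist constants $0<A\le B<\infty$ such that $A\|x\|^2\le\sum_{i\in I}\langle\Phi_i x,\Psi_i x\rangle\le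 B\|x\|^2$ for all $x\in\mathcal{H}$. For $K\in\mathcal{B}(\mathcal{H})$, the pair is a $K$-bi-$g$-frame for $\mathcal{H}$ with respect to $\{\mathcal{K}_i\}_{i\in I}$ if there exist constants $0<A\le B<\infty$ such that $A\|K^{*}x\|^2\le\sum_{i\in I}\langle\Phi_i x,\Psi_i x\rangle\le B\|x\|^2$ for all $x\in\mathcal{H}$. The bi-$g$-frame operator is $S_{\Phi,\Psi}:\mathcal{H}\to\mathcal{H}$, $S_{\Phi,\Psi}x=\sum_{i\in I}\Psi_i^{*}\Phi_i x$. *)

(* Defs.v *)
From HB Require Import structures.
From mathcomp Require Import all_boot all_order all_algebra sesquilinear finmap.
From mathcomp Require Import complex.
From mathcomp Require Import all_classical all_reals all_analysis.
From mathcomp Require summability.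
Set Implicit Arguments.
Unset Strict Implicit.
Unset Printing Implicit Defensive.
Import Order.TTheory GRing.Theory Num.Def Num.Theory.
Import numFieldNormedType.Exports.
Local Open Scope classical_set_scope.
Local Open Scope complex_scope.
Local Open Scope ring_scope.

(* Complex Hilbert spaces: the inner product is linear in its first argument,
   conjugate-linear in the second, and induces the norm. *)
HB.mixin Record CompleteNormedModule_isHilbert (R : realType) H
    of CompleteNormedModule R[i] H := {
  inner : {dot H for (@conjC R[i])} ;
  inner_norm : forall x : H, inner x x = `|x| ^+ 2 }.

#[short(type="hilbertType")]
HB.structure Definition Hilbert (R : realType) :=
  {H of CompleteNormedModule_isHilbert R H & CompleteNormedModule R[i] H}.

Local Notation "''[' x , y ]" := (inner x y) : ring_scope.

Definition separable (T : topologicalType) : Prop :=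
  exists2 D : set T, countable D & dense D.

(* Unordered sums over an index type, as limits along the finite subsets; the
   value [unordered_sum f] is meaningful only when [unordered_cvg f]. *)
Definition unordered_cvg (I : choiceType) (C : numFieldType)
    (V : normedModType C) (f : I -> V) : Prop :=
  cvg (summability.partial_sum f @ summability.totally).

Notation unordered_sum := summability.sum.

Section Operators.
Context {R : realType} {H : hilbertType R}.

Definition closed_subspace (V : set H) : Prop :=
  [/\ V 0, forall (a : R[i]) u v, V u -> V v -> V (a *: u + v) & closed V].

Definition bounded_op (T : {linear H -> H}) : Prop :=
  exists M : R, forall x, `|T x| <= M%:C * `|x|.

(* An element of B(H, V), for a subspace V of H, is represented by the operator
   on H obtained by enlarging its codomain. *)
Definition bounded_op_into (V : set H) (T : {linear H -> H}) : Prop :=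
  bounded_op T /\ forall x, V (T x).

(* The vector [adjoint T y] is unique, and exists by the Riesz theorem when T is
   bounded.  When T takes its values in a closed subspace V, the adjoint V -> H
   of T : H -> V satisfies the same identity for y in V, so it is the
   restriction of [adjoint T] to V. *)
Definition adjoint (T : H -> H) (y : H) : H :=
  xget 0 [set z | forall x, '[T x, y] = '[x, z]].

(* In the order of R[i], [0 <= z] says that z is real and nonnegative. *)
Definition positive_op (T : H -> H) : Prop := forall x, 0 <= '[T x, x].

Definition is_sqrt_op (T : H -> H) (Q : {linear H -> H}) : Prop :=
  [/\ bounded_op Q, positive_op Q & forall x, Q (Q x) = T x].

Section Frames.
Context {I : countType}.
Implicit Types (W : I -> set H) (Phi Psi : I -> {linear H -> H}).

(* R[i]^o rather than R[i]: only the former carries the norm topology. *)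
Definition frame_form Phi Psi (x : H) (i : I) : R[i]^o := '[Phi i x, Psi i x].

Definition bi_g_frame W Phi Psi : Prop :=
  (forall i, bounded_op_into (W i) (Phi i) /\ bounded_op_into (W i) (Psi i)) /\
  exists A B : R, [/\ 0 < A, A <= B & forall x,
    [/\ unordered_cvg (frame_form Phi Psi x),
        A%:C * `|x| ^+ 2 <= unordered_sum (frame_form Phi Psi x) :> R[i] &
        unordered_sum (frame_form Phi Psi x) <= B%:C * `|x| ^+ 2 :> R[i]]].

Definition K_bi_g_frame (K : {linear H -> H}) W Phi Psi : Prop :=
  (forall i, bounded_op_into (W i) (Phi i) /\ bounded_op_into (W i) (Psi i)) /\
  exists A B : R, [/\ 0 < A, A <= B & forall x,
    [/\ unordered_cvg (frame_form Phi Psi x),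
        A%:C * `|adjoint K x| ^+ 2 <= unordered_sum (frame_form Phi Psi x) :> R[i] &
        unordered_sum (frame_form Phi Psi x) <= B%:C * `|x| ^+ 2 :> R[i]]].

Definition bi_g_frame_op Phi Psi (x : H) : H :=
  unordered_sum (fun i => adjoint (Psi i) (Phi i x)).

End Frames.
End Operators.

(* Main.v *)
Require Import Defs.
From HB Require Import structures.
From mathcomp Require Import all_boot all_order all_algebra.
From mathcomp Require Import all_classical all_reals all_analysis.
From mathcomp Require Import sesquilinear finmap complex ring lra.
From mathcomp Require summability.
Set Implicit Arguments.
Unset Strict Implicit.
Unset Printing Implicit Defensive.
Import Order.TTheory GRing.Theory Num.Theory.
Import numFieldNormedType.Exports.
Local Open Scope classical_set_scope.
Local Open Scope complex_scope.
Local Open Scope ring_scope.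

(** A bi-g-frame makes the square root Q of its frame operator S invertible, so
    that both conditions hold for every bounded K.  For all x,
    [A |x|^2 <= sum_i <Phi_i x, Psi_i x> = <S x, x> = <Q (Q x), x> = |Q x|^2],
    because Q is self-adjoint.  Hence Q is bounded below; being self-adjoint, it
    is then also onto, and [U = Q^-1 K] is bounded.  In the other direction
    [|K^* x| <= |K| |x|] turns the lower frame bound A into a lower K-frame
    bound.

    Three facts of Hilbert space theory carry this argument.

    - [coercive_representation]: for Q bounded and bounded below, every bounded
      linear functional f is of the form [h |-> <Q h, Q z>], where z minimises
      [|Q x|^2 - 2 Re f(x)].  For Q the identity this is the Riesz
      representation theorem, which provides the adjoints
      ([inner_adjoint]); for a self-adjoint Q and [f h = <h, w>] it solves
      [Q (Q z) = w], hence gives surjectivity ([selfadjoint_surjective]).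

    - [weakly_bounded_bounded]: the uniform boundedness principle for vectors.

    - [bounded_partial_sums_cvg]: in a Hilbert space, a family whose finite
      partial sums are bounded in norm is unconditionally summable.

    The last two are needed since the frame condition only says something about
    the quadratic form: that the series [sum_i Psi_i^* Phi_i x] defining S x
    converges in norm, so that its terms may be paired with x one by one, has to
    be derived.  By polarization the scalar families
    [<Phi_i x, Psi_i y> = <Psi_i^* Phi_i x, y>] are summable, so their finite
    partial sums are bounded for each y; thus those of [Psi_i^* Phi_i x] are
    bounded in norm, and the family is summable ([Re_frame_sum]).

    Estimates are carried out with the real-valued norm [rnorm] and the real
    inner product [rip], for which the order of R is total. *)

(** * The underlying real inner product space *)

Section RealStructure.
Context {R : realType} {H : hilbertType R}.
Implicit Types (x y z : H) (a : R).

Definition rnorm x : R := complex.Re `|x|.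
Definition rip x y : R := complex.Re (inner x y).

Lemma rnormE x : `|x| = (rnorm x)%:C.
Proof. by rewrite /rnorm RRe_real. Qed.

Lemma rnorm_ge0 x : 0 <= rnorm x.
Proof. rewrite -lecR -rnormE; exact: normr_ge0. Qed.

Lemma rnorm0 : rnorm 0 = 0. Proof. by rewrite /rnorm normr0. Qed.

Lemma rnorm_eq0 x : rnorm x = 0 -> x = 0.
Proof. by move=> x0; apply: normr0_eq0; rewrite rnormE x0. Qed.

Lemma rnormN x : rnorm (- x) = rnorm x.
Proof. by rewrite /rnorm normrN. Qed.

Lemma rnormD x y : rnorm (x + y) <= rnorm x + rnorm y.
Proof. by rewrite -lecR rmorphD/= -!rnormE ler_normD. Qed.

Lemma rnormB x y : rnorm (x - y) = rnorm (y - x).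
Proof. by rewrite -rnormN opprB. Qed.

Lemma rnormZ a x : rnorm (a%:C *: x) = `|a| * rnorm x.
Proof.
apply: complexI; rewrite -rnormE normrZ rmorphM/= -rnormE; congr (_ * _).
by rewrite normc_def /= expr0n addr0 sqrtr_sqr.
Qed.

Lemma innerC x y : inner y x = (inner x y)^*.
Proof. by rewrite (hermC _ y x) expr0 mul1r. Qed.

Lemma ripC x y : rip y x = rip x y.
Proof. by rewrite /rip innerC; case: (inner x y). Qed.

Lemma ripDl x y z : rip (x + y) z = rip x z + rip y z.
Proof. by rewrite /rip linearDl raddfD. Qed.

Lemma ripDr x y z : rip z (x + y) = rip z x + rip z y.
Proof. by rewrite ripC ripDl !(ripC z). Qed.

Lemma ripZl a x y : rip (a%:C *: x) y = a * rip x y.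
Proof. by rewrite /rip linearZl_LR/=; case: (inner x y) => b c /=; ring. Qed.

Lemma ripZr a x y : rip y (a%:C *: x) = a * rip y x.
Proof. by rewrite ripC ripZl ripC. Qed.

Lemma ripNl x y : rip (- x) y = - rip x y.
Proof. by rewrite /rip linearNl raddfN. Qed.

Lemma ripNr x y : rip y (- x) = - rip y x.
Proof. by rewrite ripC ripNl ripC. Qed.

Lemma ripxx x : rip x x = rnorm x ^+ 2.
Proof. by rewrite /rip inner_norm rnormE -rmorphXn. Qed.

Definition ripE := (ripDl, ripDr, ripNl, ripNr, ripZl, ripZr).

Lemma polarization (p q r s : H) : inner p s *+ 4 =
  inner (p + q) (r + s) - inner (p - q) (r - s)
  + 'i%C * (inner (p + 'i%C *: q) (r + 'i%C *: s)
            - inner (p - 'i%C *: q) (r - 'i%C *: s)).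
Proof.
have ci : ('i%C : R[i])^* = - 'i%C.
  by apply/eqP; rewrite eq_complex /= oppr0 !eqxx.
rewrite !(linearDl, linearDr, linearNl, linearNr, linearZl_LR, linearZr_LR)/=.
rewrite ci; case: (inner p r) (inner p s) (inner q r) (inner q s) =>
  [a1 b1] [a2 b2] [a3 b3] [a4 b4].
apply/eqP; rewrite eq_complex /=; apply/andP; split; apply/eqP; ring.
Qed.

Lemma rnorm_parallelogram x y :
  rnorm (x + y) ^+ 2 + rnorm (x - y) ^+ 2 = 2 * (rnorm x ^+ 2 + rnorm y ^+ 2).
Proof. by rewrite -!ripxx !ripE (ripC x y); ring. Qed.

Lemma rip_CauchySchwarz x y : `|rip x y| <= rnorm x * rnorm y.
Proof.
have [y0|y0] := eqVneq (rnorm y) 0.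
  by rewrite (rnorm_eq0 y0) /rip linear0r normr0 rnorm0 mulr0.
have yp : 0 < rnorm y by rewrite lt_def y0 rnorm_ge0.
have q t : 0 <= rnorm x ^+ 2 + 2 * t * rip x y + t ^+ 2 * rnorm y ^+ 2.
  suff -> : rnorm x ^+ 2 + 2 * t * rip x y + t ^+ 2 * rnorm y ^+ 2 =
      rnorm (x + t%:C *: y) ^+ 2 by rewrite sqr_ge0.
  by rewrite -!ripxx !ripE (ripC x y); ring.
rewrite -(@ler_pXn2r _ 2)// ?nnegrE ?mulr_ge0 ?rnorm_ge0//.
rewrite real_normK ?num_real// exprMn -subr_ge0.
have yp2 : 0 < rnorm y ^+ 2 by rewrite exprn_gt0.
(* The quadratic polynomial in t takes its minimum here. *)
have := mulr_ge0 (ltW yp2) (q (- rip x y / rnorm y ^+ 2)).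
by congr (0 <= _); field; exact: y0.
Qed.

Lemma scalar_0 (f : H -> R[i]) : linear_for *%R f -> f 0 = 0.
Proof.
move=> lf; have := lf 1 0 0; rewrite scaler0 addr0 mul1r.
by move/(congr1 (fun u => u - f 0)); rewrite subrr addrK => <-.
Qed.

(** The imaginary part of a complex functional at h is minus its real part at
    ['i *: h]. *)
Lemma scalar_eq_Re (f g : H -> R[i]) :
  linear_for *%R f -> linear_for *%R g ->
  (forall h, complex.Re (f h) = complex.Re (g h)) -> f =1 g.
Proof.
move=> lf lg e h; have := e h; have := e ('i%C *: h).
rewrite -[_ *: h]addr0 lf lg !scalar_0// !addr0.
by case: (f h) => p q; case: (g h) => r s /=; simpc => /oppr_inj -> ->.
Qed.

(** Completeness, with real tolerances: the same criterion serves for sequences,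
    for unordered sums and for near-minimisers of a functional. *)
Lemma complete_filter (T : Type) (F : set_system T) (f : T -> H) :
  ProperFilter F ->
  (forall e : R, 0 < e -> exists2 A : set T, F A &
     forall s t, A s -> A t -> rnorm (f s - f t) < e) ->
  exists l, forall e : R, 0 < e -> \forall t \near F, rnorm (f t - l) < e.
Proof.
move=> FF cF.
have cf : cvg (f @ F).
  apply/cauchy_cvgP; apply/cauchyP => e e0.
  have er : e = (complex.Re e)%:C by rewrite RRe_real// gtr0_real.
  move: e0; rewrite er ltcR => e0.
  have [A FA Ae] := cF _ e0.
  have [t0 At0] := filter_ex FA.
  exists (f t0); rewrite /fmap/= nbhs_simpl; apply: filterS FA => t At /=.
  by rewrite -ball_normE/= rnormE ltcR; exact: Ae.
exists (lim (f @ F)) => e e0.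
have : 0 < e%:C by rewrite ltcR.
move/cvgrPdist_lt: cf => /[apply]; apply: filterS => t.
by rewrite rnormE ltcR rnormB.
Qed.

End RealStructure.

(** * Representation of functionals by a coercive form *)

Section Variational.
Context {R : realType} {H : hilbertType R}.
Implicit Types (x y z : H) (a : R).

Lemma linear_of_inner_op (Q : {linear H -> H}) z :
  linear_for *%R (fun h => inner (Q h) z).
Proof. by move=> a u v; rewrite linearP linearDl linearZl_LR. Qed.

(** The Riesz argument with [|Q x|] in place of [|x|].  The functional
    [J x = |Q x|^2 - 2 Re f(x)] is bounded below by coercivity; its
    near-minimisers form a Cauchy filter by the parallelogram law; and at the
    limit the first variation of J vanishes. *)
Lemma coercive_representation (Q : {linear H -> H}) (f : H -> R[i])
    (c M N : R) :
  0 < c -> (forall x, c * rnorm x <= rnorm (Q x)) ->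
  (forall x, rnorm (Q x) <= M * rnorm x) ->
  linear_for *%R f -> (forall x, `|complex.Re (f x)| <= N * rnorm x) ->
  exists z, forall h, inner (Q h) (Q z) = f h.
Proof.
move=> c0 cQ QM lf fN.
pose g x := complex.Re (f x).
have f0 := scalar_0 lf.
have gD x y : g (x + y) = g x + g y.
  by rewrite /g -[x]scale1r lf mul1r scale1r raddfD.
have gZ a x : g (a%:C *: x) = a * g x.
  rewrite /g -[_ *: x]addr0 lf f0 addr0.
  by case: (f x) => p q /=; rewrite mul0r subr0.
have QZ a x : Q (a%:C *: x) = a%:C *: Q x by rewrite linearZ.
pose J x := rnorm (Q x) ^+ 2 - 2 * g x.
have JD x h : J (x + h) = J x + rnorm (Q h) ^+ 2 + 2 * (rip (Q h) (Q x) - g h).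
  by rewrite /J linearD -!ripxx !ripE (ripC (Q h)) gD; ring.
pose rJ := [set J x | x in setT].
have lbJ : has_inf rJ.
  split; first by exists (J 0), 0.
  exists (- (N / c) ^+ 2) => _ [x _ <-]; rewrite /J.
  have h1 : g x <= N * rnorm x by exact: le_trans (ler_norm _) (fN x).
  have h2 := cQ x.
  have h3 : (c * rnorm x) ^+ 2 <= rnorm (Q x) ^+ 2.
    by rewrite lerXn2r// nnegrE ?mulr_ge0 ?rnorm_ge0// ltW.
  have h4 : 0 <= (c * rnorm x - N / c) ^+ 2 by exact: sqr_ge0.
  have h5 : (c * rnorm x - N / c) ^+ 2 =
    (c * rnorm x) ^+ 2 - 2 * (N * rnorm x) + (N / c) ^+ 2.
    by field; exact: lt0r_neq0.
  by lra.
pose m := inf rJ.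
have mJ x : m <= J x by apply: ge_inf; [exact: lbJ.2|exists x].
pose near_min (e : R) := [set x | J x < m + e].
pose F := filter_from [set e : R | 0 < e] near_min.
have FF : ProperFilter F.
  apply: filter_from_proper; last first.
    move=> e e0; have [_ [x _ <-] Jx] := inf_adherent e0 lbJ.
    by exists x.
  apply: filter_from_filter; first by exists 1; rewrite /= ltr01.
  move=> e1 e2 /= e10 e20; exists (Num.min e1 e2).
    by rewrite /= lt_min e10.
  by move=> x; rewrite /near_min/= => h; split; apply: (lt_le_trans h);
    rewrite lerD2l ge_min lexx ?orbT.
(* For w half of x - y, the point y + w is the midpoint of x and y, where
   [m <= J] as well. *)
have near_close x y e : J x < m + e -> J y < m + e ->
    (c * rnorm (x - y)) ^+ 2 <= 4 * e.
  move=> xe ye; pose w := (2^-1)%:C *: (x - y).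
  have ex : x = y + w + w.
    rewrite -addrA /w -scalerDl -rmorphD/=.
    by rewrite (_ : 2^-1 + 2^-1 = 1); [rewrite scale1r subrKC|lra].
  have m1 := mJ (y + w).
  have : rnorm (Q (x - y)) ^+ 2 = 2 * (J x + J y - 2 * J (y + w)).
    rewrite ex (_ : y + w + w - y = w + w); last first.
      by rewrite addrC -(addrA y) addKr.
    rewrite !(JD _ w) linearD -!ripxx linearD !ripE; ring.
  have : (c * rnorm (x - y)) ^+ 2 <= rnorm (Q (x - y)) ^+ 2.
    by rewrite lerXn2r// nnegrE ?mulr_ge0 ?rnorm_ge0// ltW.
  by lra.
have [z zP] : exists z, forall e : R, 0 < e ->
    \forall x \near F, rnorm (x - z) < e.
  apply: (@complete_filter _ _ _ F id) => e e0.
  exists (near_min ((c * e) ^+ 2 / 8)).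
    exists ((c * e) ^+ 2 / 8) => //=.
    by rewrite divr_gt0// exprn_gt0// mulr_gt0.
  move=> x y xe ye; have h := near_close _ _ _ xe ye.
  rewrite -(ltr_pM2l c0) -(@ltr_pXn2r _ 2)// ?nnegrE ?mulr_ge0 ?rnorm_ge0//
    ?(ltW c0) ?(ltW e0)//.
  apply: (le_lt_trans h).
  have : 0 < (c * e) ^+ 2 by rewrite exprn_gt0// mulr_gt0.
  by lra.
exists z; apply: scalar_eq_Re => //; first exact: linear_of_inner_op.
move=> h; rewrite -/(g h) -/(rip _ _).
have M0 x : 0 <= `|M| * rnorm x by rewrite mulr_ge0 ?rnorm_ge0.
(* This says [J z <= J (z + k)], and follows from [m <= J (x + k)] as x tends
   to z along the near-minimisers. *)
have opt k : 0 <= rnorm (Q k) ^+ 2 + 2 * (rip (Q k) (Q z) - g k).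
  apply/ler_addgt0Pl => e e0.
  pose b := 2 * (rnorm (Q k) * `|M|) + 1.
  have b0 : 0 < b by rewrite /b ltr_wpDl// !mulr_ge0 ?rnorm_ge0.
  have [x [xz xm]] : exists x, rnorm (x - z) < e / 2 / b /\ J x < m + e / 2.
    apply: (@filter_ex _ F); apply: filterI; last by exists (e / 2) => //=; lra.
    by apply: zP; rewrite !divr_gt0.
  have := mJ (x + k); rewrite JD => h1.
  have h2 : rip (Q k) (Q x) - rip (Q k) (Q z) = rip (Q k) (Q (x - z)).
    by rewrite linearB !ripE.
  have h3 : rip (Q k) (Q (x - z)) <= rnorm (Q k) * (`|M| * rnorm (x - z)).
    apply: (le_trans (ler_norm _)); apply: (le_trans (rip_CauchySchwarz _ _)).
    rewrite ler_wpM2l ?rnorm_ge0//; apply: (le_trans (QM _)).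
    by rewrite ler_wpM2r ?rnorm_ge0// ler_norm.
  have h4 : b * rnorm (x - z) < e / 2 by rewrite mulrC -ltr_pdivlMr.
  have h5 : b * rnorm (x - z) =
    2 * (rnorm (Q k) * (`|M| * rnorm (x - z))) + rnorm (x - z).
    by rewrite /b; ring.
  have h6 := rnorm_ge0 (x - z).
  by lra.
pose d := rip (Q h) (Q z) - g h.
suff : d = 0 by move/eqP; rewrite subr_eq0 => /eqP.
pose q := rnorm (Q h) ^+ 2.
have opt' t : 0 <= t ^+ 2 * q + 2 * t * d.
  have := opt (t%:C *: h).
  rewrite QZ rnormZ ripZl gZ exprMn real_normK ?num_real//.
  by congr (0 <= _); rewrite /d /q; ring.
have q0 : 0 <= q by exact: sqr_ge0.
have q1 : 0 < q + 1 by lra.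
(* The optimal step is - d / q, but q may vanish. *)
have := opt' (- d / (q + 1)).
have -> : (- d / (q + 1)) ^+ 2 * q + 2 * (- d / (q + 1)) * d =
    - (d ^+ 2 * ((q + 2) / (q + 1) ^+ 2)) by field; lra.
rewrite oppr_ge0 pmulr_lle0 ?divr_gt0 ?exprn_gt0//; last by lra.
by move=> d2; apply/eqP; rewrite -sqrf_eq0 eq_le d2 sqr_ge0.
Qed.

End Variational.

(** * Uniform boundedness *)

Section UniformBoundedness.
Context {R : realType} {H : hilbertType R}.

(** If the norms were unbounded, pick vectors [w n] of norm above [n 3^n] and
    walk from 0 by steps of length [3^-n] along [w n], with the sign that makes
    [|<x_(n+1), w n>|] at least [3^-n |w n|].  All later steps together have
    length at most [3^-n / 2], so the limit l of the walk still satisfies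
    [|<l, w n>| >= 3^-n |w n| / 2 >= n / 2], against boundedness at l. *)
Lemma weakly_bounded_bounded (J : Type) (s : J -> H) :
  (forall y, exists M : R, forall j, `|rip (s j) y| <= M) ->
  exists C : R, forall j, rnorm (s j) <= C.
Proof.
move=> wb; apply: contrapT => /forallNP unb.
pose r n : R := (3 ^ n)%:R^-1.
have r0 n : 0 < r n by rewrite invr_gt0 ltr0n expn_gt0.
have rS n : r n = 3 * r n.+1.
  by rewrite /r expnS natrM invfM mulVKf// pnatr_eq0.
have /choice[t tP] : forall n, exists j, n%:R * (3 ^ n)%:R < rnorm (s j).
  move=> n; have /existsNP[j /negP] := unb (n%:R * (3 ^ n)%:R).
  by rewrite -ltNge => ?; exists j.
pose w n := s (t n).
have w0 n : 0 < rnorm (w n) by apply: le_lt_trans (tP n); rewrite mulr_ge0.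
pose sgn n (x : H) : R := if 0 <= rip x (w n) then 1 else -1.
have sgn1 n x : `|sgn n x| = 1.
  by rewrite /sgn; case: ifP; rewrite ?normrN normr1.
have sgnE n x : rip x (w n) = sgn n x * `|rip x (w n)|.
  rewrite /sgn; case: ifP => [x0|/negbT]; first by rewrite ger0_norm ?mul1r.
  by rewrite -ltNge => x0; rewrite ltr0_norm// mulN1r opprK.
pose xs := fix xs n := if n is p.+1 then
  xs p + (sgn p (xs p) * (r p / rnorm (w p)))%:C *: w p else 0 : H.
have xsS n : rnorm (xs n.+1 - xs n) = r n.
  rewrite /= addrC addKr rnormZ normrM sgn1 mul1r gtr0_norm ?divr_gt0//.
  by rewrite divfK// gt_eqF.
have xs_large n : r n * rnorm (w n) <= `|rip (xs n.+1) (w n)|.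
  rewrite /= ripDl ripZl ripxx [X in X + _]sgnE -mulrA -mulrDr normrM.
  rewrite sgn1 mul1r.
  apply: le_trans (ler_norm _); rewrite expr2 mulrA divfK ?gt_eqF//.
  by rewrite lerDr.
have xs_dist n k : rnorm (xs (n + k)%N - xs n) <= 3 / 2 * r n.
  elim: k n => [|k IH] n.
    by rewrite addn0 subrr rnorm0 mulr_ge0// ltW.
  rewrite addnS -addSn -(subrK (xs n.+1) (xs (n.+1 + k)%N)) -addrA.
  apply: (le_trans (rnormD _ _)); rewrite xsS.
  have := IH n.+1; have := rS n; lra.
have r_small (e : R) : 0 < e -> exists n, r n < e.
  move=> e0; exists (Num.truncn e^-1).+1.
  rewrite /r -[ltRHS]invrK ltf_pV2 ?posrE ?invr_gt0 ?ltr0n ?expn_gt0//.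
  apply: (lt_trans (truncnS_gt _)).
  by rewrite ltr_nat ltn_expl.
have [l lP] : exists l, forall e : R, 0 < e ->
    \forall n \near \oo, rnorm (xs n - l) < e.
  apply: complete_filter => e e0.
  have [n rn] : exists n, r n < e / 3 by apply: r_small; rewrite divr_gt0.
  exists [set k | (n <= k)%N]; first by exists n.
  move=> i j /= ni nj; rewrite -(subrK (xs n) (xs i)) -addrA.
  apply: (le_lt_trans (rnormD _ _)); rewrite (rnormB (xs n)).
  have := xs_dist n (i - n)%N; have := xs_dist n (j - n)%N.
  by rewrite !subnKC//; lra.
have l_dist n : rnorm (xs n - l) <= 3 / 2 * r n.
  apply/ler_addgt0Pl => e e0; have [N _ NP] := lP _ e0.
  rewrite -(subrK (xs (n + N)%N) (xs n)) -addrA.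
  apply: (le_trans (rnormD _ _)); rewrite rnormB.
  have := NP (n + N)%N (leq_addl _ _); have := xs_dist n N; rewrite /=; lra.
have l_large n : n%:R / 2 <= `|rip (w n) l|.
  have h1 : r n * rnorm (w n) / 2 <= `|rip (w n) l|.
    have h2 : rip (w n) l = rip (xs n.+1) (w n) - rip (xs n.+1 - l) (w n).
      by rewrite !ripE (ripC (w n) l); ring.
    have h3 := rip_CauchySchwarz (xs n.+1 - l) (w n).
    have h4 : rnorm (xs n.+1 - l) * rnorm (w n) <= r n / 2 * rnorm (w n).
      rewrite ler_wpM2r ?rnorm_ge0//.
      by have := l_dist n.+1; have := rS n; lra.
    have h5 := lerB_dist (rip (xs n.+1) (w n)) (rip (xs n.+1 - l) (w n)).
    have h6 := xs_large n.
    by rewrite h2; lra.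
  apply: le_trans h1; rewrite ler_pM2r ?invr_gt0//.
  by rewrite mulrC ler_pdivlMr ?ltr0n ?expn_gt0// ltW.
have [M MP] := wb l.
have := truncnS_gt (2 * M); have := l_large (Num.truncn (2 * M)).+1.
by have := MP (t (Num.truncn (2 * M)).+1); rewrite -/(w _); lra.
Qed.

End UniformBoundedness.

(** * Unordered sums *)

Section UnorderedSums.
Import summability.
#[local] Existing Instance totally_filter.
Local Open Scope fset_scope.
Local Open Scope ring_scope.

Lemma partial_sum_setU (I : choiceType) (V : zmodType) (v : I -> V)
    (A B : {fset I}) :
  partial_sum v (A `|` B) = partial_sum v A + partial_sum v (B `\` A).
Proof.
rewrite /partial_sum -!(big_seq_fsetE _ _ predT) /= -big_cat.
apply: perm_big; apply: uniq_perm; first exact: fset_uniq.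
  rewrite cat_uniq !fset_uniq andbT /=; apply/hasPn => i /=.
  by rewrite inE => /andP[].
by move=> i; rewrite mem_cat !inE; case: (i \in A).
Qed.

Lemma partial_sum_split (I : choiceType) (V : zmodType) (v : I -> V)
    (A B : {fset I}) :
  A `<=` B -> partial_sum v B = partial_sum v A + partial_sum v (B `\` A).
Proof. by move=> AB; rewrite -partial_sum_setU (fsetUidPr _ _ AB). Qed.

(** Beyond some finite F0 the partial sums are within 1 of the limit; those over
    other sets A differ from the one over [F0 `|` A] by terms of index in F0. *)
Lemma unordered_cvg_bounded (R : realType) (I : choiceType) (f : I -> R[i]^o) :
  unordered_cvg f ->
  exists M : R, forall A : {fset I}, `|partial_sum f A| <= M%:C :> R[i].
Proof.
move=> /cvgrPdist_lt/(_ 1 ltr01)[F0 _ F0P].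
set l := lim _ in F0P.
pose a := `|l : R[i]| + 1 + \sum_(i <- F0) `|f i : R[i]|.
have aR : a = (complex.Re a)%:C.
  rewrite RRe_real// !realD ?normr_real ?real1//.
  by apply: rpred_sum => i _; exact: normr_real.
exists (complex.Re a) => A; rewrite -aR.
have -> : partial_sum f A =
    - (l - partial_sum f (F0 `|` A)) + l - partial_sum f (F0 `\` A).
  by rewrite fsetUC partial_sum_setU opprB subrK addrK.
apply: (le_trans (ler_normB _ _)); apply: lerD.
  apply: (le_trans (ler_normD _ _)); rewrite normrN addrC lerD2l.
  by apply/ltW/F0P; exact: fsubsetUl.
apply: (le_trans (ler_norm_sum _ _ _)).
rewrite -(big_seq_fsetE _ _ predT (fun i => `|f i : R[i]|)) /=.
have -> : \sum_(i <- F0) `|f i : R[i]| = \sum_(i <- F0 `\` A) `|f i : R[i]|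
    + \sum_(i <- F0 `&` A) `|f i : R[i]|.
  rewrite !big_seq_fsetE /=.
  have := partial_sum_split (fun i => `|f i : R[i]|) (fsubsetDl F0 A).
  by rewrite fsetDDr fsetDv fset0U /partial_sum.
by rewrite lerDl sumr_ge0// => *; exact: normr_ge0.
Qed.

(** If the partial sums were not Cauchy, there would be differences w of two of
    them, of norm at least e and supported away from any given finite set.  For
    any y one of [|y + w|^2], [|y - w|^2] is at least [|y|^2 + |w|^2], so adding
    or subtracting such w repeatedly builds differences y of two partial sums
    with [|y|^2 >= n e^2] for every n; but [|y| <= 2 C]. *)
Lemma bounded_partial_sums_cvg (R : realType) (H : hilbertType R)
    (I : choiceType) (v : I -> H) (C : R) :
  (forall A, rnorm (partial_sum v A) <= C) ->
  forall e : R, 0 < e -> \forall A \near totally,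
    rnorm (partial_sum v A - sum v) < e.
Proof.
move=> vC.
have /complete_filter[l lP] : forall e : R, 0 < e ->
    exists2 A : set {fset I}, totally A & forall s t, A s -> A t ->
    rnorm (partial_sum v s - partial_sum v t) < e.
  move=> e e0; apply: contrapT => ncauchy.
  have far (F0 : {fset I}) : exists A B, [/\ F0 `<=` A, F0 `<=` B &
      e <= rnorm (partial_sum v A - partial_sum v B)].
    apply: contrapT => near; apply: ncauchy; exists [set A | F0 `<=` A].
      by exists F0.
    move=> A B /= FA FB; rewrite ltNge; apply/negP => eAB.
    by apply: near; exists A, B.
  have grow n : exists A B,
      n%:R * e ^+ 2 <= rnorm (partial_sum v A - partial_sum v B) ^+ 2.
    elim: n => [|n [A [B AB]]].
      by exists fset0, fset0; rewrite mul0r sqr_ge0.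
    have [A' [B' [FA FB eAB]]] := far (A `|` B).
    move: FA FB; rewrite !fsubUset => /andP[AA' BA'] /andP[AB' BB'].
    pose y := partial_sum v A - partial_sum v B.
    pose w := partial_sum v A' - partial_sum v B'.
    have yw := rnorm_parallelogram y w.
    have ew : e ^+ 2 <= rnorm w ^+ 2.
      by rewrite lerXn2r// ?nnegrE ?rnorm_ge0// ltW.
    pose D := A `|` B.
    have new (X Y : {fset I}) : X `<=` D -> D `<=` Y ->
        partial_sum v (X `|` (Y `\` D)) =
        partial_sum v X + (partial_sum v Y - partial_sum v D).
      move=> XD DY; rewrite partial_sum_setU fsetDDl (fsetUidPl _ _ XD).
      rewrite (partial_sum_split _ DY) (addrAC (partial_sum v D)).
      by rewrite subrr add0r.
    have DA' : D `<=` A' by rewrite fsubUset AA'.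
    have DB' : D `<=` B' by rewrite fsubUset AB'.
    have [h|h] := leP (rnorm y ^+ 2 + rnorm w ^+ 2) (rnorm (y + w) ^+ 2).
    + exists (A `|` (A' `\` D)), (B `|` (B' `\` D)).
      rewrite !new ?fsubsetUl ?fsubsetUr// opprD addrACA opprB subrKA.
      by move: AB h ew; rewrite -/y -/w -natr1 mulrDl mul1r; lra.
    + exists (A `|` (B' `\` D)), (B `|` (A' `\` D)).
      rewrite !new ?fsubsetUl ?fsubsetUr// opprD addrACA opprB subrKA.
      rewrite -[partial_sum v B' - _]opprB -/y -/w.
      by move: AB h ew yw; rewrite -/y -natr1 mulrDl mul1r; lra.
  have [A [B]] := grow (Num.truncn ((2 * C) ^+ 2 / e ^+ 2)).+1.
  have e2 : 0 < e ^+ 2 by rewrite exprn_gt0.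
  have := truncnS_gt ((2 * C) ^+ 2 / e ^+ 2); rewrite ltr_pdivrMr// => h1 h2.
  have := lt_le_trans h1 h2; apply/negP; rewrite -leNgt.
  have C0 : 0 <= C by exact: le_trans (rnorm_ge0 _) (vC fset0).
  rewrite lerXn2r// ?nnegrE ?rnorm_ge0 ?mulr_ge0//.
  apply: (le_trans (rnormD _ _)); rewrite rnormN.
  by have := vC A; have := vC B; lra.
suff -> : sum v = l by [].
apply: (@cvg_lim _ _ _ totally) => //; apply/cvgrPdist_lt => e e0.
have er : e = (complex.Re e)%:C by rewrite RRe_real// gtr0_real.
move: e0; rewrite er ltcR => /lP; apply: filterS => A.
by rewrite rnormB rnormE ltcR.
Qed.

End UnorderedSums.

(** * Adjoints *)

Section Adjoint.
Context {R : realType} {H : hilbertType R}.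
Implicit Types (T : {linear H -> H}).

Lemma bounded_op_rnorm T : bounded_op T ->
  exists2 M : R, 0 <= M & forall x, rnorm (T x) <= M * rnorm x.
Proof.
move=> [M TM]; exists `|M| => // x; apply: (@le_trans _ _ (M * rnorm x)).
  by rewrite -lecR rmorphM/= -!rnormE.
by rewrite ler_wpM2r ?rnorm_ge0// ler_norm.
Qed.

Lemma inner_adjoint T : bounded_op T ->
  forall x y, inner (T x) y = inner x (adjoint T y).
Proof.
move=> /bounded_op_rnorm[M M0 TM] x y.
suff : exists z, forall h, inner (T h) y = inner h z.
  by move=> /(xgetPex 0); exact.
have [|||||z zP] := @coercive_representation R H idfun
    (fun h => inner (T h) y) 1 1 (M * rnorm y).
- exact: ltr01.
- by move=> h; rewrite mul1r.
- by move=> h; rewrite mul1r.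
- exact: linear_of_inner_op.
- move=> h; apply: (le_trans (rip_CauchySchwarz _ _)).
  by rewrite mulrAC ler_wpM2r ?rnorm_ge0.
by exists z => h; rewrite -zP.
Qed.

Lemma rnorm_adjoint_le T (M : R) : 0 <= M ->
  (forall x, rnorm (T x) <= M * rnorm x) ->
  forall y, rnorm (adjoint T y) <= M * rnorm y.
Proof.
move=> M0 TM y; rewrite /adjoint; case: xgetP => [z _ /= zP|_]; last first.
  by rewrite rnorm0 mulr_ge0 ?rnorm_ge0.
have [->|z0] := eqVneq (rnorm z) 0; first by rewrite mulr_ge0 ?rnorm_ge0.
have zp : 0 < rnorm z by rewrite lt_def z0 rnorm_ge0.
rewrite -(ler_pM2l zp) -expr2 -ripxx {1}/rip -zP.
apply: (le_trans (ler_norm _)); apply: (le_trans (rip_CauchySchwarz _ _)).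
by rewrite mulrA (mulrC (rnorm z)) ler_wpM2r ?rnorm_ge0.
Qed.

(** Representing [h |-> <h, w>] as [h |-> <Q h, Q z> = <h, Q (Q z)>] gives
    [Q (Q z) = w]. *)
Lemma selfadjoint_surjective (Q : {linear H -> H}) (c : R) :
  bounded_op Q -> adjoint Q =1 Q ->
  0 < c -> (forall x, c * rnorm x <= rnorm (Q x)) ->
  forall w, exists u, Q u = w.
Proof.
move=> bQ Qsa c0 cQ w; have [M _ QM] := bounded_op_rnorm bQ.
have [||z zP] := @coercive_representation R H Q (fun h => inner h w) c M
  (rnorm w) c0 cQ QM.
- exact: (linear_of_inner_op idfun).
- by move=> h; apply: (le_trans (rip_CauchySchwarz _ _)); rewrite mulrC.
exists (Q z); apply/eqP; rewrite -subr_eq0; apply/eqP/rnorm_eq0/eqP.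
rewrite -sqrf_eq0 -ripxx ripDr ripNr {1}/rip.
by rewrite -[X in inner _ X]Qsa -inner_adjoint// zP subrr.
Qed.

(** The operator U is [Q^-1 K]. *)
Lemma factor_through_selfadjoint (Q K : {linear H -> H}) (c : R) :
  bounded_op Q -> bounded_op K -> adjoint Q =1 Q ->
  0 < c -> (forall x, c * rnorm x <= rnorm (Q x)) ->
  exists2 U : {linear H -> H}, bounded_op U & forall x, K x = Q (U x).
Proof.
move=> bQ /bounded_op_rnorm[M M0 KM] Qsa c0 cQ.
have Qinj u v : Q u = Q v -> u = v.
  move=> uv; apply/eqP; rewrite -subr_eq0; apply/eqP/rnorm_eq0/eqP.
  rewrite eq_le rnorm_ge0 andbT -(pmulr_rle0 _ c0).
  by apply: (le_trans (cQ _)); rewrite linearB uv subrr rnorm0.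
have /choice[U UP] : forall x, exists u, Q u = K x.
  by move=> x; exact: (selfadjoint_surjective bQ Qsa c0 cQ).
have Ulin : linear U by move=> a u v; apply: Qinj; rewrite linearP !UP linearP.
pose L : {linear H -> H} := HB.pack U (GRing.isLinear.Build _ _ _ _ U Ulin).
exists L => [|x]; last by rewrite /= UP.
exists (M / c) => x; rewrite /= !rnormE -rmorphM/= lecR.
rewrite mulrAC ler_pdivlMr// mulrC; apply: (le_trans (cQ _)).
by rewrite UP.
Qed.

End Adjoint.

(** * The frame operator *)

Section FrameOperator.
Import summability.
#[local] Existing Instance totally_filter.
Context {R : realType} {H : hilbertType R} {I : countType}.
Implicit Types (Phi Psi : I -> {linear H -> H}).

Lemma inner_partial_sum (v : I -> H) (y : H) A :
  inner (partial_sum v A) y = partial_sum (fun i => inner (v i) y : R[i]^o) A.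
Proof. by rewrite /partial_sum linear_sumlz. Qed.

(** By polarization, from the four families on the diagonal. *)
Lemma weak_partial_sums_bounded Phi Psi x y :
  (forall z, unordered_cvg (frame_form Phi Psi z)) ->
  exists M : R, forall A, `|complex.Re
    (partial_sum (fun i => inner (Phi i x) (Psi i y) : R[i]^o) A)| <= M.
Proof.
move=> cF.
have [M1 M1P] := unordered_cvg_bounded (cF (x + y)).
have [M2 M2P] := unordered_cvg_bounded (cF (x - y)).
have [M3 M3P] := unordered_cvg_bounded (cF (x + 'i%C *: y)).
have [M4 M4P] := unordered_cvg_bounded (cF (x - 'i%C *: y)).
exists ((M1 + M2 + (M3 + M4)) / 4) => A.
set P := partial_sum _ A.
have PE : P *+ 4 =
    partial_sum (frame_form Phi Psi (x + y)) A
  - partial_sum (frame_form Phi Psi (x - y)) A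
  + 'i%C * (partial_sum (frame_form Phi Psi (x + 'i%C *: y)) A
         - partial_sum (frame_form Phi Psi (x - 'i%C *: y)) A).
  rewrite /P /partial_sum -!sumrB mulr_sumr -big_split/= -sumrMnl.
  apply: eq_bigr => i _; rewrite /frame_form.
  have TE (T : {linear H -> H}) :
      [/\ T (x + y) = T x + T y, T (x - y) = T x - T y,
          T (x + 'i%C *: y) = T x + 'i%C *: T y &
          T (x - 'i%C *: y) = T x - 'i%C *: T y].
    by split; rewrite ?linearB ?linearD ?linearZ.
  have [-> -> -> ->] := TE (Phi (val i)).
  have [-> -> -> ->] := TE (Psi (val i)).
  exact: polarization.
have PM : `|P *+ 4| <= (M1 + M2 + (M3 + M4))%:C :> R[i].
  rewrite PE !rmorphD/=; apply: (le_trans (ler_normD _ _)).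
  rewrite normrM (normc_def 'i%C)/= expr0n expr1n add0r sqrtr1 mul1r.
  by apply: lerD; apply: (le_trans (ler_normB _ _)); apply: lerD.
rewrite ler_pdivlMr// mulr_natr -normrMn -raddfMn -lecR.
exact: le_trans (normc_ge_Re _) PM.
Qed.

(** What has to be shown is that the series defining the frame operator
    converges in norm: its partial sums are weakly bounded, hence bounded, hence
    convergent. *)
Lemma Re_frame_sum Phi Psi :
  (forall i, bounded_op (Psi i)) ->
  (forall z, unordered_cvg (frame_form Phi Psi z)) ->
  forall x, complex.Re (unordered_sum (frame_form Phi Psi x)) =
    rip (bi_g_frame_op Phi Psi x) x.
Proof.
move=> bPsi cF x; pose v i := adjoint (Psi i) (Phi i x).
have vE i y : inner (v i) y = inner (Phi i x) (Psi i y).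
  by rewrite innerC -inner_adjoint// -innerC.
have sE A y : rip (partial_sum v A) y =
    complex.Re (partial_sum (fun i => inner (Phi i x) (Psi i y) : R[i]^o) A).
  rewrite /rip inner_partial_sum; congr (complex.Re _).
  by apply: eq_bigr => i _; exact: vE.
have [C vC] : exists C : R, forall A, rnorm (partial_sum v A) <= C.
  apply: weakly_bounded_bounded => y.
  have [M MP] := weak_partial_sums_bounded x y cF.
  by exists M => A; rewrite sE.
have vcvg := bounded_partial_sums_cvg vC.
apply/eqP; rewrite -subr_eq0 -normr_le0; apply/ler_addgt0Pr => e e0.
rewrite add0r -/(v) /bi_g_frame_op -/v.
pose d := e / 2 / (1 + rnorm x).
have x1 : 0 < 1 + rnorm x by rewrite ltr_wpDr ?rnorm_ge0.
have d0 : 0 < d by rewrite !divr_gt0.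
have dC : 0 < d%:C by rewrite ltcR.
have [A [h1 h2]] : exists A, rnorm (partial_sum v A - sum v) < d /\
    `|unordered_sum (frame_form Phi Psi x)
      - partial_sum (frame_form Phi Psi x) A| < d%:C.
  apply: (@filter_ex _ totally); apply: filterI; first exact: vcvg.
  by move/cvgrPdist_lt: (cF x) => /(_ _ dC).
have h3 := rip_CauchySchwarz (partial_sum v A - sum v) x.
have h4 : `|complex.Re (unordered_sum (frame_form Phi Psi x))
             - rip (partial_sum v A) x| < d.
  by rewrite sE -raddfB -ltcR; apply: le_lt_trans h2; exact: normc_ge_Re.
have -> : complex.Re (unordered_sum (frame_form Phi Psi x)) - rip (sum v) x =
   complex.Re (unordered_sum (frame_form Phi Psi x)) - rip (partial_sum v A) x
   + rip (partial_sum v A - sum v) x by rewrite ripDl ripNl; ring.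
apply: (le_trans (ler_normD _ _)).
have h5 : rnorm (partial_sum v A - sum v) * rnorm x <= d * rnorm x.
  by rewrite ler_wpM2r ?rnorm_ge0// ltW.
have h6 : d * (1 + rnorm x) = e / 2 by rewrite /d divfK// gt_eqF.
have : 0 <= d * rnorm x by rewrite mulr_ge0 ?rnorm_ge0// ltW.
lra.
Qed.

Lemma sqrt_frame_op_bounded_below W Phi Psi (Q : {linear H -> H}) :
  bi_g_frame W Phi Psi -> is_sqrt_op (bi_g_frame_op Phi Psi) Q ->
  adjoint Q =1 Q ->
  exists2 c : R, 0 < c & forall x, c * rnorm x <= rnorm (Q x).
Proof.
move=> [bW [A [B [A0 AB frame]]]] [bQ _ QQ] Qsa.
have cF z : unordered_cvg (frame_form Phi Psi z) by have [] := frame z.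
exists (Num.sqrt A); first by rewrite sqrtr_gt0.
move=> x; rewrite -(@ler_pXn2r _ 2)// ?nnegrE ?mulr_ge0 ?sqrtr_ge0 ?rnorm_ge0//.
rewrite exprMn sqr_sqrtr ?(ltW A0)//.
have -> : rnorm (Q x) ^+ 2 = complex.Re (unordered_sum (frame_form Phi Psi x)).
  rewrite Re_frame_sum//; last by move=> i; case: (bW i) => _ [].
  by rewrite -QQ -ripxx [LHS]/rip inner_adjoint// Qsa; exact: ripC.
have [_ + _] := frame x; rewrite rnormE -rmorphXn -rmorphM/= lecE => /andP[_].
by [].
Qed.

End FrameOperator.

Lemma bi_g_frame_K_bi_g_frame (R : realType) (H : hilbertType R) (I : countType)
    (W : I -> set H) (K : {linear H -> H}) (Phi Psi : I -> {linear H -> H}) :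
  bounded_op K -> bi_g_frame W Phi Psi -> K_bi_g_frame K W Phi Psi.
Proof.
move=> /bounded_op_rnorm[M M0 KM] [bW [A [B [A0 AB frame]]]]; split=> //.
(* The 1 keeps the denominator positive when M = 0. *)
have M1 : 0 < M ^+ 2 + 1 by rewrite ltr_wpDl ?sqr_ge0.
have AM : A / (M ^+ 2 + 1) <= A.
  by rewrite ler_pdivrMr// ler_peMr ?(ltW A0)// lerDr sqr_ge0.
exists (A / (M ^+ 2 + 1)), B; split; [exact: divr_gt0|exact: le_trans AM AB|].
move=> x; have [cvg_x lower upper] := frame x; split=> //.
apply: le_trans lower; rewrite !rnormE -!rmorphXn -!rmorphM lecR.
rewrite mulrAC ler_pdivrMr// -mulrA ler_pM2l//.
apply: (@le_trans _ _ ((M * rnorm x) ^+ 2)).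
  by rewrite lerXn2r ?nnegrE ?mulr_ge0 ?rnorm_ge0 ?rnorm_adjoint_le.
by rewrite exprMn mulrC ler_wpM2l ?sqr_ge0// lerDl.
Qed.

(* [sqrtS] is the positive square root of the bi-g-frame operator. *)
Theorem theorem3p13 (R : realType) (H : hilbertType R) (I : countType)
    (W : I -> set H) (K : {linear H -> H}) (Phi Psi : I -> {linear H -> H})
    (sqrtS : {linear H -> H}) :
  separable H ->
  (forall i, closed_subspace (W i)) ->
  bounded_op K ->
  bi_g_frame W Phi Psi ->
  is_sqrt_op (bi_g_frame_op Phi Psi) sqrtS ->
  adjoint sqrtS =1 sqrtS ->
  K_bi_g_frame K W Phi Psi <->
  exists2 U : {linear H -> H}, bounded_op U & forall x, K x = sqrtS (U x).
Proof.
move=> _ _ bK frame sqrtSP sqrtS_sa; split=> _; last first.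
  exact: bi_g_frame_K_bi_g_frame.
have [c c0 cQ] := sqrt_frame_op_bounded_below frame sqrtSP sqrtS_sa.
have [bQ _ _] := sqrtSP.
exact: (factor_through_selfadjoint bQ bK sqrtS_sa c0 cQ).
Qed.
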